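(* Let $G=(V,E)$ be a finite connected weighted graph with symmetric edge weights $\omega$ and positive vertex measure $\mu$, and let $\Delta$ be the associated Laplacian. Let $\kappa:V\to\mathbb{R}$ satisfy $\int_V\kappa\,d\mu<0$, and let $K:V\to\mathbb{R}$ satisfy $K\le\max_V K=0$ and $K\not\equiv 0$. For $\lambda\in\mathbb{R}$ put $K_\lambda=K+\lambda$ and consider the equation $$\Delta u+\kappa-K_\lambda e^{2u}=0\quad\text{on } V \qquad (\ast)_\lambda$$ for an unknown function $u:V\to\mathbb{R}$. Then there exists $\lambda^*\in(0,-\min_V K)$ such that: 1. if $\lambda\le 0$, then $(\ast)_\lambda$ has a unique solution; 2. if $0<\lambda<\lambda^*$, then $(\ast)_\lambda$ has at least two distinct solutions; 3. if $\lambda=\lambda^*$, then $(\ast)_\lambda$ has at least one solution; 4. if $\lambda>\lambda^*$, then $(\ast)_\lambda$ has no solution.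
   Context: $G=(V,E)$ is a finite connected graph. The edge weights are given by a symmetric function $\omega:V\times V\to[0,\infty)$, $\omega_{xy}=\omega_{yx}$, with $\omega_{xy}>0$ for each edge $xy\in E$; $y\sim x$ means that $xy$ is an edge. The measure $\mu:V\to(0,\infty)$ is an arbitrary positive function. For $u:V\to\mathbb{R}$, $\int_V u\,d\mu=\sum_{x\in V}\mu(x)u(x)$. The Laplacian (with the sign making it a nonnegative operator) is $$\Delta f(x)=\frac{1}{\mu(x)}\sum_{y\sim x}\omega_{xy}\,(f(x)-f(y)).$$ *)

(* Defs.v *)
From HB Require Import structures.
From mathcomp Require Import all_boot all_order all_algebra.
From mathcomp Require Import all_classical all_reals all_analysis.
Set Implicit Arguments. Unset Strict Implicit. Unset Printing Implicit Defensive.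
Import Order.TTheory GRing.Theory Num.Theory.
Local Open Scope ring_scope.

Definition simple_graph (V : finType) (e : rel V) : Prop :=
  symmetric e /\ irreflexive e.

Definition connected_graph (V : finType) (e : rel V) : Prop :=
  (0 < #|V|)%N /\ forall x y : V, connect e x y.

(* The weight may be positive on non-adjacent pairs, but [laplacian] never
   uses those values: it sums over the neighbours only. *)
Definition edge_weight (R : realType) (V : finType) (e : rel V)
    (w : V -> V -> R) : Prop :=
  [/\ forall x y, 0 <= w x y,
      forall x y, w x y = w y x
    & forall x y, e x y -> 0 < w x y].

Definition integral_mu (R : realType) (V : finType) (mu u : V -> R) : R :=
  \sum_(x : V) mu x * u x.

Definition laplacian (R : realType) (V : finType) (e : rel V)
    (w : V -> V -> R) (mu : V -> R) (f : V -> R) (x : V) : R :=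
  (mu x)^-1 * \sum_(y : V | e x y) w x y * (f x - f y).

(* The default value 0 is only reached when V is empty. *)
Definition max_on (R : realType) (V : finType) (f : V -> R) : R :=
  if [pick x : V] is Some x0 then f [arg max_(x > x0) f x]%O else 0.

Definition min_on (R : realType) (V : finType) (f : V -> R) : R :=
  if [pick x : V] is Some x0 then f [arg min_(x < x0) f x]%O else 0.

Lemma max_onP (R : realType) (V : finType) (f : V -> R) : (0 < #|V|)%N ->
  (exists x, f x = max_on f) /\ forall x, f x <= max_on f.
Proof.
move=> /card_gt0P[z _]; rewrite /max_on; case: pickP => [x0 _|/(_ z)//].
by case: arg_maxP => // i _ hi; split; [exists i | move=> x; apply: hi].
Qed.

Lemma min_onP (R : realType) (V : finType) (f : V -> R) : (0 < #|V|)%N ->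
  (exists x, f x = min_on f) /\ forall x, min_on f <= f x.
Proof.
move=> /card_gt0P[z _]; rewrite /min_on; case: pickP => [x0 _|/(_ z)//].
by case: arg_minP => // i _ hi; split; [exists i | move=> x; apply: hi].
Qed.

Definition solution (R : realType) (V : finType) (e : rel V)
    (w : V -> V -> R) (mu kappa K : V -> R) (lam : R) (u : V -> R) : Prop :=
  forall x : V,
    laplacian e w mu u x + kappa x - (K x + lam) * expR (2 * u x) = 0.

(* Main.v *)
Require Import Defs.
From HB Require Import structures.
From mathcomp Require Import all_boot all_order all_algebra.
From mathcomp Require Import all_classical all_reals all_analysis.
From mathcomp Require Import ring lra.
Set Implicit Arguments. Unset Strict Implicit. Unset Printing Implicit Defensive.
Import Order.TTheory GRing.Theory Num.Theory.
Import numFieldNormedType.Exports.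
Local Open Scope classical_set_scope.
Local Open Scope ring_scope.

(** Multiplied by [mu x], the equation at [x] says that the gradient of

      E(u) = 1/2 sum_x u(x) lap u(x) + sum_x k(x) u(x)
             - 1/2 sum_x a(x) exp(2 u(x))

    vanishes, where [lap = mu * laplacian] is symmetric, [k = mu * kappa] and
    [a = mu * (K + lam)]; this gradient is [residual k a u].

    Compactness comes from one Harnack-type estimate, [lap_harnack]: if [lap u]
    is bounded above along the way, then [u] stays within a fixed distance of
    its maximum until the bound fails.  Applied to [- u], it shows that if [u]
    dipped very low it would be very low everywhere, and then the sum of the
    residuals would be close to [\sum_x k x < 0] ([residual_lower_bound]).
    Applied to [u], it carries a large maximum to a vertex where [a] does not
    vanish, and there the exponential term cannot be balanced
    ([residual_upper_bound]).  So approximate solutions are bounded.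

    The set of [lam] for which the equation has a solution is a half-line with
    a largest element:
    - A solution for [lam'] is a supersolution for every [lam <= lam'], and the
      minimizer of E below a supersolution solves the equation
      ([supersolution_minimizer]); hence the set is closed downwards.
    - At [lam = 0], a large multiple of a function with positive Laplacian off
      a vertex where [K < 0], plus a constant, is a strict supersolution, so
      some [lam > 0] belongs to the set ([small_supersolution]).
    - Summing the equation over V excludes [lam >= - min K], and the bounds
      above make the supremum [lamstar] a member ([solvable_closed]).
    For [lam <= 0] the exponential term is monotone, which gives uniqueness
    ([residual_unique]).

    For [0 < lam < lamstar] the solution for [lamstar] is a strict
    supersolution, so the minimizer [u0] below it is a free local minimum of E.
    Either E takes the value E(u0) on a small sphere around [u0], at a point
    that is then a second local minimum; or the sphere is a ridge, and since E
    is not larger than E(u0) far out along a vertex where [a > 0], a mountain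
    pass gives a critical point at a higher level ([two_solutions]).  The
    mountain pass theorem is proved with an explicit, continuous gradient step
    in place of a flow ([mountain_pass]). *)

(** * Elementary inequalities *)

Lemma ler_sum_norm (R : realDomainType) (I : finType) (f : I -> R) (i : I) :
  f i <= \sum_j `|f j|.
Proof.
by apply: le_trans (ler_norm _) _; rewrite (bigD1 i)//= lerDl sumr_ge0.
Qed.

Lemma normr_le_sum (R : realDomainType) (I : finType) (f : I -> R) (i : I) :
  `|f i| <= \sum_j `|f j|.
Proof. by rewrite (bigD1 i)//= lerDl sumr_ge0. Qed.

Lemma pos_lower_bound (R : realFieldType) (I : finType) (f : I -> R) :
  (forall i, 0 < f i) -> exists2 c : R, 0 < c & forall i, c <= f i.
Proof.
move=> f_gt0; pose S := \sum_i (f i)^-1.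
have S_ge0 : 0 <= S by apply: sumr_ge0 => i _; rewrite invr_ge0 ltW.
exists (1 + S)^-1 => [|i]; first by rewrite invr_gt0; lra.
rewrite -[leRHS]invrK lef_pV2 ?posrE ?invr_gt0 //; last lra.
rewrite (le_trans (_ : _ <= S)) //; last lra.
by rewrite /S (bigD1 i)//= lerDl sumr_ge0 // => j _; rewrite invr_ge0 ltW.
Qed.

Lemma expR_ge_const (R : realType) (s D y : R) :
  0 < s -> s <= D * expR y -> - (D / s) <= y.
Proof.
move=> s0 sD; have ey := expR_gt0 y.
have : s * expR (- y) <= D by rewrite expRN ler_pdivrMr.
have := expR_ge1Dx (- y) => h sy; have : s * (1 - y) <= D by nra.
rewrite lerNl ler_pdivlMr // => ?; nra.
Qed.

(** An exponential outgrows an affine function.  This turns the balance of the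
    exponential term against a Laplacian of linear growth into an upper
    bound. *)
Lemma expR_le_affine (R : realType) (alpha c p q : R) : 0 < alpha ->
  exists M, forall t, alpha * expR (2 * (t - c)) <= p * t + q -> t <= M.
Proof.
move=> a0; pose Q := `|p / 2| + `|p * c + q|.
exists (c + (1 + 2 * Q / alpha)) => t.
set s := 2 * (t - c); have -> : t = c + s / 2 by rewrite /s; field.
rewrite lerD2l => H.
have Q0 : 0 <= Q by rewrite addr_ge0.
have QA : 0 <= 2 * Q / alpha by rewrite divr_ge0 ?(ltW a0) ?mulr_ge0.
have [s1|s1] := leP s 1; first lra.
suff : s <= 2 * Q / alpha by lra.
rewrite ler_pdivlMr // -(ler_pM2l (lt_trans ltr01 s1)).
have e2 : s ^+ 2 / 2 <= expR s.
  have := expR_ge1Dxn 1 (ltW (lt_trans ltr01 s1)).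
  by rewrite (_ : 2`! = 2%N) //; lra.
have : alpha * (s ^+ 2 / 2) <= p * (c + s / 2) + q.
  by apply: le_trans H; rewrite ler_wpM2l ?(ltW a0).
have := ler_norm (p / 2); have := ler_norm (p * c + q); rewrite /Q.
set X := `|p / 2|; set Y := `|_ + _|; rewrite expr2 => ? ? ?.
have : 0 <= Y by exact: normr_ge0.
nra.
Qed.

(** The upper half is [expR y <= 1 / (1 - y)], which for [y <= 1 / 2] lies
    below [1 + y + 2 y^2]. *)
Lemma expR_quadratic (R : realType) (y : R) :
  `|y| <= 1 / 2 -> `|expR y - 1 - y| <= 2 * y ^+ 2.
Proof.
rewrite ler_norml => /andP[y1 y2]; have ey := expR_ge1Dx y.
rewrite ger0_norm; last lra.
have e0 := expR_gt0 y.
have : expR y * (1 - y) <= 1.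
  have := expR_ge1Dx (- y); rewrite -(ler_pM2l e0) -expRD subrr expR0; lra.
have : 1 <= (1 + y + 2 * y ^+ 2) * (1 - y) by rewrite expr2; nra.
nra.
Qed.

(** * Continuity and compactness in the space of functions on a finite set *)

Lemma continuous_compf (S T U : topologicalType) (f : S -> T) (g : T -> U) :
  continuous f -> continuous g -> continuous (fun s => g (f s)).
Proof. by move=> fc gc s; apply: continuous_comp (fc s) _; exact: gc. Qed.

Section ContinuousRealFunctions.
Variables (R : realType) (T : topologicalType).
Implicit Types f g : T -> R.

Lemma continuous_addf f g :
  continuous f -> continuous g -> continuous (fun u => f u + g u).
Proof. by move=> fc gc u; apply: cvgD; [exact: fc|exact: gc]. Qed.

Lemma continuous_oppf f : continuous f -> continuous (fun u => - f u).
Proof. by move=> fc u; apply: cvgN; exact: fc. Qed.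

Lemma continuous_mulf f g :
  continuous f -> continuous g -> continuous (fun u => f u * g u).
Proof. by move=> fc gc u; apply: cvgM; [exact: fc|exact: gc]. Qed.

Lemma continuous_invf f :
  (forall u, f u != 0) -> continuous f -> continuous (fun u => (f u)^-1).
Proof. by move=> f0 fc u; apply: cvgV => //; exact: fc. Qed.

Lemma continuous_normf f : continuous f -> continuous (fun u => `|f u|).
Proof. by move=> fc u; apply: cvg_norm; exact: fc. Qed.

Lemma continuous_expf f : continuous f -> continuous (fun u => expR (f u)).
Proof. by move=> fc u; apply: continuous_comp (fc u) _; exact: continuous_expR. Qed.

Lemma continuous_sumf (I : finType) (P : pred I) (F : I -> T -> R) :
  (forall i, continuous (F i)) -> continuous (fun u => \sum_(i | P i) F i u).
Proof. by move=> Fc; apply: continuous_big => // -[x y]; exact: add_continuous. Qed.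

End ContinuousRealFunctions.

Section Levels.
Variables (R : realType) (T : topologicalType) (f : T -> R).
Hypothesis f_cont : continuous f.

Lemma closed_superlevel (b : R) : closed [set u | b <= f u].
Proof.
apply: (@preimage_closed _ _ f [set x | b <= x]); last exact: closed_ge.
by move=> u _; exact: f_cont.
Qed.

Lemma closed_level (b : R) : closed [set u | f u = b].
Proof.
apply: (@preimage_closed _ _ f [set x | x = b]); last exact: closed_eq.
by move=> u _; exact: f_cont.
Qed.

Lemma open_sublevel (b : R) : open [set u | f u < b].
Proof.
apply: (@open_comp _ _ f [set x | x < b]); last exact: open_lt.
by move=> u _; exact: f_cont.
Qed.

Lemma open_superlevel (b : R) : open [set u | b < f u].
Proof.
apply: (@open_comp _ _ f [set x | b < x]); last exact: open_gt.
by move=> u _; exact: f_cont.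
Qed.

End Levels.

Section ProductTopology.
Import ArrowAsProduct.
Variables (R : realType) (V : finType).
Implicit Types (u v lo hi : V -> R) (E : (V -> R) -> R).

Lemma continuous_eval (x : V) : continuous (fun u : V -> R => u x).
Proof. exact: (@proj_continuous V (fun=> R) x). Qed.

Lemma continuous_coord (T : topologicalType) (f : T -> V -> R) :
  (forall x, continuous (fun t => f t x)) -> continuous f.
Proof.
move=> fc t; apply/cvg_sup => x.
move=> A [B [[C oC <-] /= Cft CA]].
apply: (filterS CA); apply: fc; exact: open_nbhs_nbhs.
Qed.

Lemma compact_box lo hi : compact [set u : V -> R | forall x, lo x <= u x <= hi x].
Proof.
have := @tychonoff V (fun=> R) (fun x => [set` `[lo x, hi x]])
  (fun x => @segment_compact R _ _).
by congr compact; apply/seteqP; split=> u /= H x; have := H x; rewrite /= in_itv.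
Qed.

Lemma closed_box lo hi : closed [set u : V -> R | forall x, lo x <= u x <= hi x].
Proof.
apply: compact_closed; last exact: compact_box.
by apply: hausdorff_product => x; exact: Rhausdorff.
Qed.

Lemma box_argmin E (D : set (V -> R)) lo hi : continuous E -> closed D ->
  D !=set0 -> (forall u, D u -> forall x, lo x <= u x <= hi x) ->
  exists2 u, D u & forall v, D v -> E u <= E v.
Proof.
move=> Ec Dc D0 Dbox.
have Dcomp : compact D by exact: (subclosed_compact Dc (@compact_box lo hi) Dbox).
have [u uD uE] := compact_EVT_min D0 Dcomp (continuous_subspaceT Ec).
by exists u => [|v vD]; [exact: set_mem|apply: uE; exact: mem_set].
Qed.

End ProductTopology.

(** * A mountain pass theorem by discrete gradient descent *)

Section MountainPass.
Import ArrowAsProduct.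
Variables (R : realType) (V : finType).
Implicit Types (u v : V -> R).

(** [rho] is a function whose zero set separates the two valleys; [d] is a
    descent direction, [tau] an admissible step length and [G] a squared slope.
    Boundedness of the points of small slope stands for the Palais-Smale
    condition. *)
Variables (E rho G tau : (V -> R) -> R) (d : (V -> R) -> V -> R).
Variables (beta delta B : R).
Hypothesis E_cont : continuous E.
Hypothesis rho_cont : continuous rho.
Hypothesis G_cont : continuous G.
Hypothesis tau_cont : continuous tau.
Hypothesis d_cont : forall x, continuous (fun u => d u x).
Hypothesis tau_ge0 : forall u, 0 <= tau u.
Hypothesis tau_gt0 : forall u, 0 < G u -> 0 < tau u.
Hypothesis descent : forall u (s : R), 0 <= s <= tau u ->
  E (fun x => u x + s * d u x) <= E u - s / 2 * G u.
Hypothesis d_le_G : forall u x, d u x ^+ 2 <= G u.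
Hypothesis G_ge0 : forall u, 0 <= G u.
Hypothesis delta_gt0 : 0 < delta.
Hypothesis small_slope_bounded : forall u, G u <= delta -> forall x, - B <= u x <= B.
Hypothesis ridge : forall u, rho u = 0 -> beta <= E u.

(** A step is taken everywhere with the continuous length [tau], so iterates
    depend continuously on their starting point. *)
Let flow u : V -> R := fun x => u x + tau u * d u x.

Lemma flow_descent u : E (flow u) <= E u - tau u / 2 * G u.
Proof. by apply: descent; rewrite tau_ge0 lexx. Qed.

Lemma flow_le u : E (flow u) <= E u.
Proof.
have := flow_descent u; have := mulr_ge0 (tau_ge0 u) (G_ge0 u); lra.
Qed.

Lemma continuous_flow : continuous flow.
Proof.
apply: continuous_coord => x; apply: continuous_addf; first exact: continuous_eval.
by apply: continuous_mulf.
Qed.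

(** E does not increase along the segment from [u] to [flow u], so the
    segment remains strictly below the level [beta] of the ridge and cannot
    cross it. *)
Lemma flow_same_side u : E u < beta -> (rho (flow u) < 0) = (rho u < 0).
Proof.
move=> Eu.
pose g s := rho (fun x => u x + s * d u x).
have gc : continuous g.
  apply: continuous_compf rho_cont.
  apply: continuous_coord => x; apply: continuous_addf; first exact: cst_continuous.
  by apply: continuous_mulf; [move=> ?; exact: cvg_id|exact: cst_continuous].
have g0 : g 0 = rho u by congr rho; apply/funext => x; rewrite mul0r addr0.
have nz s : 0 <= s <= tau u -> g s != 0.
  move=> s_tau; apply/eqP => /ridge; apply/negP; rewrite -ltNge.
  apply: le_lt_trans (descent s_tau) _; move/andP: s_tau => [s0 _].
  by have := mulr_ge0 s0 (G_ge0 u); lra.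
have nz0 := nz 0; rewrite lexx tau_ge0 in nz0; have {}nz0 := nz0 isT.
have nz1 := nz (tau u); rewrite lexx tau_ge0 in nz1; have {}nz1 := nz1 isT.
have noroot : ~ exists2 s, s \in `[0, tau u] & g s = 0.
  by move=> [s]; rewrite in_itv => /nz /eqP.
have ivt := @IVT R g 0 (tau u) 0 (tau_ge0 u) (continuous_subspaceT gc).
rewrite -/(g (tau u)) -g0.
case: (ltgtP (g 0) 0) nz0 => // g0s _; case: (ltgtP (g (tau u)) 0) nz1 => // g1s _.
  exfalso; apply: noroot; have [|s] := ivt; last by exists s.
  by rewrite ge_min le_max (ltW g0s) (ltW g1s) orbT.
exfalso; apply: noroot; have [|s] := ivt; last by exists s.
by rewrite ge_min le_max (ltW g0s) (ltW g1s) orbT.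
Qed.

Lemma iter_flow_same_side n u : E u < beta ->
  E (iter n flow u) < beta /\ (rho (iter n flow u) < 0) = (rho u < 0).
Proof.
move=> Eu; elim: n => [//|n [IH1 IH2]] /=; split.
  exact: le_lt_trans (flow_le _) IH1.
by rewrite flow_same_side.
Qed.

(** This makes the slope and the step length bounded below wherever the orbit
    of [orbit_enters_sublevel] lives. *)
Lemma positive_on_bounded_superlevel (F : (V -> R) -> R) (lo hi : V -> R) :
  continuous F -> (forall u, beta <= E u -> 0 < F u) ->
  exists2 c : R, 0 < c & forall u, beta <= E u ->
    (forall x, lo x <= u x <= hi x) -> c <= F u.
Proof.
move=> Fc F0.
pose D := [set u : V -> R | forall x, lo x <= u x <= hi x] `&` [set u | beta <= E u].
have [D0|nD] := pselect (D !=set0); last first.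
  by exists 1 => // u Eu ub; exfalso; apply: nD; exists u.
have Dc : closed D by apply: closedI; [exact: closed_box|exact: closed_superlevel].
have [|u [_ Eu] uF] := @box_argmin R V F D lo hi Fc Dc D0.
  by move=> u [].
by exists (F u) => [|v Ev vb]; [exact: F0|apply: uF].
Qed.

(** Suppose an orbit stayed above [beta].  The slope there is bounded below: by
    [delta] outside a box, and by compactness inside.  The length of a step is
    then at most a constant times the energy it gains, and the total gain is
    bounded, so the orbit is bounded; on a bounded set the step lengths are
    bounded below, and each step gains a fixed amount, which is absurd. *)
Lemma orbit_enters_sublevel u : (forall v, beta <= E v -> 0 < G v) ->
  exists n, E (iter n flow u) < beta.
Proof.
move=> G0; apply: contrapT => never.
have Eb n : beta <= E (iter n flow u).
  by rewrite leNgt; apply/negP => h; apply: never; exists n.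
have [c c0 cP] := positive_on_bounded_superlevel (fun=> - B) (fun=> B) G_cont G0.
pose eta := Num.min delta c.
have eta0 : 0 < eta by rewrite lt_min delta_gt0.
have etaP v : beta <= E v -> eta <= G v.
  move=> Ev; have [Gs|/ltW Gd] := leP (G v) delta.
    by rewrite ge_min (cP v Ev (small_slope_bounded Gs)) orbT.
  by rewrite ge_min Gd.
(* [q] is a lower bound for the slope itself, [G] being its square. *)
have [q q0 qq] : exists2 q : R, 0 < q & q ^+ 2 <= eta.
  by exists (Num.sqrt eta); rewrite ?sqrtr_gt0 // sqr_sqrtr ?(ltW eta0).
have dq v x : beta <= E v -> `|d v x| * q <= G v.
  move=> Ev; have := etaP v Ev; have := d_le_G v x => dG eG.
  have := normr_ge0 (d v x) => n0.
  rewrite -(@ler_pXn2r _ 2) ?nnegrE ?G_ge0 ?mulr_ge0 ?(ltW q0) //.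
  rewrite exprMn real_normK ?num_real // [leRHS]expr2 ler_pM ?sqr_ge0 //.
  exact: le_trans qq eG.
pose r := 2 * (E u - beta) / q.
have travel n x : `|iter n flow u x - u x| <= 2 * (E u - E (iter n flow u)) / q.
  elim: n => [|n IH] /=; first by rewrite !subrr normr0 mulr0 mul0r.
  set v := iter n flow u in IH *.
  have : `|flow v x - v x| <= 2 * (E v - E (flow v)) / q.
    rewrite ler_pdivlMr // /flow addrAC subrr add0r normrM (ger0_norm (tau_ge0 v)).
    have := dq v x (Eb n); have := flow_descent v; rewrite -/v -/(flow v).
    have := tau_ge0 v => t0 h1 /(ler_wpM2l t0); lra.
  have := ler_normD (flow v x - v x) (v x - u x).
  rewrite addrA subrK => h1 h2.
  apply: le_trans h1 _; apply: le_trans (lerD h2 IH) _.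
  by rewrite -mulrDl ler_wpM2r ?invr_ge0 ?(ltW q0) //; lra.
have inbox n x : u x - r <= iter n flow u x <= u x + r.
  have : `|iter n flow u x - u x| <= r.
    apply: le_trans (travel n x) _; rewrite ler_wpM2r ?invr_ge0 ?(ltW q0) //.
    by have := Eb n; lra.
  by rewrite ler_norml => /andP[? ?]; apply/andP; split; lra.
have [t t0 tP] := positive_on_bounded_superlevel (fun x => u x - r)
  (fun x => u x + r) tau_cont (fun v Ev => tau_gt0 (G0 v Ev)).
have drop n : E (iter n flow u) <= E u - n%:R * (t / 2 * eta).
  elim: n => [|n IH] /=; first by rewrite mul0r subr0.
  set v := iter n flow u in IH *.
  have te : t * eta <= tau v * G v.
    apply: ler_pM; rewrite ?(ltW t0) ?(ltW eta0) //.
      by apply: tP; [exact: Eb|exact: inbox].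
    by apply: etaP; exact: Eb.
  have := flow_descent v; rewrite -[n.+1%:R]natr1; lra.
have te0 : 0 < t / 2 * eta by rewrite mulr_gt0 // divr_gt0.
have ratio0 : 0 <= (E u - beta) / (t / 2 * eta).
  by rewrite divr_ge0 ?(ltW te0) // subr_ge0; exact: (Eb 0%N).
have := archi_boundP ratio0; set n := Num.bound _ => nP.
rewrite ltr_pdivrMr // in nP.
have := drop n; have := Eb n; lra.
Qed.

(** Without a critical point above [beta], every point of the line through [u0]
    and [u1] would eventually descend below [beta], on exactly one side of the
    ridge.  The starting points of the two kinds form disjoint nonempty open
    sets that cover the line, contradicting its connectedness. *)
Lemma mountain_pass u0 u1 : E u0 < beta -> rho u0 < 0 -> E u1 < beta -> 0 < rho u1 ->
  exists2 u, G u = 0 & beta <= E u.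
Proof.
move=> E0 r0 E1 r1; apply: contrapT => noncrit.
have G0 v : beta <= E v -> 0 < G v.
  move=> Ev; rewrite lt_neqAle G_ge0 andbT; apply/eqP => Gv.
  by apply: noncrit; exists v.
pose seg (s : R) : V -> R := fun x => u0 x + s * (u1 x - u0 x).
have segc : continuous seg.
  apply: continuous_coord => x; apply: continuous_addf; first exact: cst_continuous.
  by apply: continuous_mulf; [move=> ?; exact: cvg_id|exact: cst_continuous].
have itc n : continuous (fun s => iter n flow (seg s)).
  by elim: n => [|n IH] //=; apply: continuous_compf continuous_flow.
have sublevel_open n : open [set s | E (iter n flow (seg s)) < beta].
  by apply: open_sublevel; apply: (continuous_compf (itc n)).
pose A := \bigcup_n ([set s | E (iter n flow (seg s)) < beta]
  `&` [set s | rho (iter n flow (seg s)) < 0]).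
pose A' := \bigcup_n ([set s | E (iter n flow (seg s)) < beta]
  `&` [set s | 0 < rho (iter n flow (seg s))]).
have rhoc n : continuous (fun s => rho (iter n flow (seg s))).
  exact: continuous_compf (itc n) rho_cont.
have Ao : open A.
  apply: bigcup_open => n _; apply: openI => //.
  exact: open_sublevel.
have A'o : open A'.
  apply: bigcup_open => n _; apply: openI => //.
  exact: open_superlevel.
have AA' : A = ~` A'.
  apply/seteqP; split=> s.
    move=> [n _ /= [En rn]] [m _ /= [Em rm]].
    have side i j v : E (iter i flow v) < beta ->
        (rho (iter (j + i) flow v) < 0) = (rho (iter i flow v) < 0).
      by move=> Ei; rewrite iterD; have [] := iter_flow_same_side j Ei.
    have := side m n _ Em; rewrite addnC (side n m _ En) rn.
    by rewrite ltNge (ltW rm).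
  move=> nA's; have [n En] := orbit_enters_sublevel (seg s) G0.
  exists n => //; split => //=; rewrite ltNge le_eqVlt; apply/negP => /orP[/eqP r_eq0|r_pos].
    by have := ridge (esym r_eq0); rewrite leNgt En.
  by apply: nA's; exists n.
have Rconn : connected [set: R] by apply/connected_intervalP.
have : A = setT.
  apply: Rconn.
  - exists 0, 0%N => //; split => /=; rewrite (_ : seg 0 = u0) //;
      apply/funext => x; rewrite /seg; lra.
  - by exists A => //; rewrite setTI.
  - by exists A; rewrite ?setTI // AA'; exact: open_closedC.
rewrite AA' => AT; have : (~` A') (1 : R) by rewrite AT.
apply; exists 0%N => //; split => /=; rewrite (_ : seg 1 = u1) //;
  apply/funext => x; rewrite /seg; lra.
Qed.

End MountainPass.

(** * The graph Laplacian and its Harnack estimate *)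

Section KazdanWarner.
Import ArrowAsProduct.
Variables (R : realType) (V : finType) (e : rel V) (w : V -> V -> R).
Hypothesis e_sym : symmetric e.
Hypothesis w_sym : forall x y, w x y = w y x.
Hypothesis w_gt0 : forall x y, e x y -> 0 < w x y.
Hypothesis V_conn : forall x y, connect e x y.
Implicit Types (u v f k a d lo hi : V -> R) (x y z : V).

(** The Laplacian without the factor [(mu x)^-1]: this one is symmetric for
    the counting measure, and [mu] enters only through the coefficients. *)
Definition lap u x : R := \sum_(y | e x y) w x y * (u x - u y).

(** Summation by parts: the double sum counts every edge in both
    directions. *)
Lemma lap_green f u : \sum_x f x * lap u x =
  2^-1 * \sum_x \sum_(y | e x y) w x y * ((f x - f y) * (u x - u y)).
Proof.
have swap : \sum_x f x * lap u x =
    \sum_x \sum_(y | e x y) w x y * (f y * (u y - u x)).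
  rewrite (exchange_big_dep xpredT) //=; apply: eq_bigr => x _.
  rewrite mulr_sumr; apply: eq_big => [y|y _]; first by rewrite e_sym.
  by rewrite w_sym; ring.
have -> : \sum_x \sum_(y | e x y) w x y * ((f x - f y) * (u x - u y)) =
    \sum_x f x * lap u x + \sum_x f x * lap u x.
  rewrite {2}swap -big_split /=; apply: eq_bigr => x _.
  by rewrite mulr_sumr -big_split /=; apply: eq_bigr => y _; ring.
by field.
Qed.

Lemma sum_lap u : \sum_x lap u x = 0.
Proof.
under eq_bigr => x _ do rewrite -[lap u x]mul1r.
rewrite (lap_green (fun=> 1)) big1 ?mulr0 // => x _.
by rewrite big1 // => y _; rewrite subrr mul0r mulr0.
Qed.

Lemma lap_selfadjoint f u : \sum_x f x * lap u x = \sum_x u x * lap f x.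
Proof.
rewrite !lap_green; congr (_ * _); apply: eq_bigr => x _; apply: eq_bigr => y _.
by rewrite [(f x - _) * _]mulrC.
Qed.

Lemma lap_nonneg u : 0 <= \sum_x u x * lap u x.
Proof.
rewrite lap_green mulr_ge0 // sumr_ge0 // => x _; rewrite sumr_ge0 // => y /w_gt0.
by rewrite -expr2 => /ltW wxy; rewrite mulr_ge0 // sqr_ge0.
Qed.

Lemma lap_lincomb u v (s : R) x :
  lap (fun y => u y + s * v y) x = lap u x + s * lap v x.
Proof. by rewrite mulr_sumr -big_split /=; apply: eq_bigr => y _; ring. Qed.

(** The comparison principle: where a function touches a majorant, its
    differences with its neighbours are the larger ones. *)
Lemma lap_touch u v x :
  (forall y, u y <= v y) -> u x = v x -> lap v x <= lap u x.
Proof.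
move=> uv uvx; apply: ler_sum => y /w_gt0 wxy.
by rewrite ler_wpM2l ?(ltW wxy) // uvx lerD2l lerN2.
Qed.

Lemma lap_const (c : R) x : lap (fun=> c) x = 0.
Proof. by rewrite /lap big1 // => y _; rewrite subrr mulr0. Qed.

Lemma lap_opp u x : lap (fun y => - u y) x = - lap u x.
Proof. by rewrite /lap -sumrN; apply: eq_bigr => y _; ring. Qed.

Lemma lap_le_range u (m M : R) x : (forall y, m <= u y <= M) ->
  `|lap u x| <= (\sum_(y | e x y) w x y) * (M - m).
Proof.
move=> um; rewrite mulr_suml (le_trans (ler_norm_sum _ _ _)) //.
apply: ler_sum => y /w_gt0 /ltW wxy; rewrite normrM (ger0_norm wxy).
rewrite ler_wpM2l // ler_norml.
by have := um x; have := um y; move=> /andP[? ?] /andP[? ?]; apply/andP; split; lra.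
Qed.

(** In [lap u x] the terms of the other neighbours are at least [- w x z * r],
    because [u x] is within [r] of the upper bound [M]; so the bound on
    [lap u x] limits the single term of [y]. *)
Lemma lap_edge_drop u x y (C r M : R) : e x y -> 0 <= r ->
  (forall z, u z <= M) -> M - r <= u x -> lap u x <= C ->
  M - (r + (C + r * \sum_(z | e x z) w x z) / w x y) <= u y.
Proof.
move=> exy r0 uM ux; rewrite /lap (bigD1 y) //= => lapC.
have wxy := w_gt0 exy.
have rest : - (r * \sum_(z | e x z) w x z) <=
    \sum_(z | e x z && (z != y)) w x z * (u x - u z).
  apply: (@le_trans _ _ (- (r * \sum_(z | e x z && (z != y)) w x z))).
    rewrite lerN2 ler_wpM2l // [leRHS](bigD1 y) //= lerDr ltW //.
  rewrite mulr_sumr -sumrN; apply: ler_sum => z /andP[/w_gt0 wxz _].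
  have := uM z; nra.
suff : u x - u y <= (C + r * \sum_(z | e x z) w x z) / w x y by lra.
rewrite ler_pdivlMr // mulrC; lra.
Qed.

(** The drop bound of one edge is iterated along a path.  Its constant depends
    on the path only, and the walk stops at the first vertex outside [P], after
    which nothing is known about [lap u]. *)
Lemma lap_path_drop (C r : R) x z : 0 <= C -> 0 <= r -> connect e x z ->
  exists2 r', 0 <= r' & forall u M (P : V -> Prop),
    (forall y, u y <= M) -> (forall y, P y -> lap u y <= C) ->
    ~ P z -> M - r <= u x -> exists2 y, ~ P y & M - r' <= u y.
Proof.
move=> C0 r0 /connectP[p]; elim: p x r r0 => [|y p IH] x r r0 /=.
  by move=> _ ->; exists r => // u M P _ _ nP ux; exists x.
move=> /andP[exy yp] zE.
have W0 : 0 <= \sum_(z | e x z) w x z by apply: sumr_ge0 => ? /w_gt0 /ltW.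
set r1 := r + (C + r * \sum_(z | e x z) w x z) / w x y.
have r01 : r <= r1.
  rewrite lerDl divr_ge0 //; last exact: ltW (w_gt0 exy).
  by rewrite addr_ge0 // mulr_ge0.
have [|r' r'0 H] := IH y r1 _ yp zE; first exact: le_trans r01.
exists (Num.max r r'); first by rewrite le_max r0.
move=> u M P uM lapP nP ux; have [Px|nPx] := pselect (P x).
  have [|y' nPy' uy'] := H u M P uM lapP nP.
    exact: lap_edge_drop exy r0 uM ux (lapP _ Px).
  exists y' => //; apply: le_trans uy'.
  by rewrite lerD2l lerN2 le_max lexx orbT.
by exists x => //; apply: le_trans ux; rewrite lerD2l lerN2 le_max lexx.
Qed.

(** Finitely many pairs of vertices have a common constant.  With [P] the
    complement of [z], the estimate says that [u z] is close to the maximum;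
    with [P] a set where an equation bounds [lap u] above, it finds a vertex
    outside this set at which [u] is close to its maximum. *)
Lemma lap_harnack (C : R) : 0 <= C ->
  exists2 r, 0 <= r & forall u (P : V -> Prop) x z,
    (forall y, u y <= u x) -> (forall y, P y -> lap u y <= C) ->
    ~ P z -> exists2 y, ~ P y & u x - r <= u y.
Proof.
move=> C0.
have /choice[r rP] : forall xz : V * V, exists r', 0 <= r' /\
    forall u M (P : V -> Prop),
    (forall y, u y <= M) -> (forall y, P y -> lap u y <= C) ->
    ~ P xz.2 -> M - 0 <= u xz.1 -> exists2 y, ~ P y & M - r' <= u y.
  move=> [x z]; have [r' r'0 H] := lap_path_drop C0 (lexx 0) (V_conn x z).
  by exists r'.
exists (\sum_i `|r i|) => [|u P x z ux lapP nP].
  by apply: sumr_ge0.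
have [_ /(_ u (u x) P ux lapP nP)[|y nPy uy]] := rP (x, z); first by rewrite subr0.
exists y => //; apply: le_trans uy; rewrite lerD2l lerN2; exact: ler_sum_norm.
Qed.

(** * Bounds for approximate solutions, and uniqueness *)

(** The defect of [u] in the equation, which is also the gradient of [energy]
    below. *)
Definition residual k a u x : R := lap u x + k x - a x * expR (2 * u x).

Lemma sum_residual k a u :
  \sum_x residual k a u x = \sum_x k x - \sum_x a x * expR (2 * u x).
Proof. by rewrite !big_split /= sum_lap // add0r sumrN. Qed.

(** The Harnack estimate for [- u] uses [u <= 0], where the exponential is at
    most 1.  If [u] is positive somewhere, its minimum is at least [- r].  If not,
    all of [u] is within [r] of its minimum, so a very low minimum makes the
    exponential terms negligible, and the residuals would sum to about
    [\sum_x k x < 0].  The one-sided hypothesis lets this apply to approximate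
    solutions and to supersolutions alike. *)
Lemma residual_lower_bound k (A : R) : \sum_x k x < 0 -> 0 <= A ->
  exists eps B : R, 0 < eps /\ forall a u, (forall x, `|a x| <= A) ->
    (forall x, - eps <= residual k a u x) -> forall x, - B <= u x.
Proof.
move=> k_lt0 A0; pose n : R := #|V|%:R; pose s := - (\sum_x k x) / 2.
have s0 : 0 < s by rewrite /s; lra.
have n0 : 0 <= n by exact: ler0n.
(* Chosen so that residuals [- eps] use up at most half of [\sum_x k x]. *)
pose eps := s / (1 + n); have eps0 : 0 < eps by rewrite divr_gt0 //; lra.
have neps : n * eps <= s.
  by rewrite /eps mulrCA ger_pMr // ler_pdivrMr ; lra.
have C0 : 0 <= \sum_x `|k x| + A + eps.
  by rewrite !addr_ge0 ?(ltW eps0) // sumr_ge0.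
have [r r0 harnack] := lap_harnack C0.
exists eps, (r + n * A / s / 2); split => // a u aA resu x.
have D0 : 0 <= n * A / s by rewrite divr_ge0 ?(ltW s0) // mulr_ge0.
suff [x0 ux0 bx0] : exists2 x0, (forall y, u x0 <= u y) & - (r + n * A / s / 2) <= u x0.
  exact: le_trans bx0 (ux0 x).
case: (@Order.TotalTheory.arg_minP _ _ _ x xpredT u) => // x0 _ ux0.
exists x0 => [y|]; first exact: ux0.
have lapu y : u y <= 0 -> lap (fun z => - u z) y <= \sum_x `|k x| + A + eps.
  move=> uy; rewrite lap_opp.
  have := resu y; rewrite /residual; have := ler_sum_norm k y.
  have : `|a y * expR (2 * u y)| <= A.
    rewrite normrM -[leRHS]mulr1 ler_pM // ger0_norm ?expR_ge0 //.
    by rewrite -[leRHS]expR0 ler_expR; lra.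
  rewrite ler_norml => /andP[? ?]; lra.
have um y : - u y <= - u x0 by rewrite lerN2 ux0.
have [[z uz]|allN] := pselect (exists z, 0 < u z).
  have [|y /negP] := harnack (fun z => - u z) (fun y => u y <= 0) x0 z um lapu.
    by apply/negP; rewrite -ltNge.
  by rewrite -ltNge; lra.
have {}allN z : u z <= 0 by rewrite leNgt; apply/negP => uz; apply: allN; exists z.
have near z : u z <= u x0 + r.
  have [//||y /contrapT -> ] := harnack (fun z => - u z) (fun y => y <> z) x0 z um.
    by move=> y _; exact: lapu.
  - by move=> /(_ erefl).
  - lra.
have sum_const c : \sum_(x : V) c = n * c by rewrite sumr_const mulr_natl.
have : - (n * eps) <= \sum_x residual k a u x.
  by rewrite -mulrN -sum_const; exact: ler_sum.
rewrite sum_residual => ressum.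
have : - (n * A * expR (2 * (u x0 + r))) <= \sum_x a x * expR (2 * u x).
  rewrite -mulrA -mulrN -sum_const; apply: ler_sum => y _; rewrite lerNl; apply: le_trans (ler_norm _) _.
  rewrite normrN normrM ler_pM // ger0_norm ?expR_ge0 // ler_expR.
  have := near y; lra.
move=> aexp; have sD : s <= n * A * expR (2 * (u x0 + r)) by rewrite /s in neps *; lra.
have := expR_ge_const s0 sD; lra.
Qed.

(** Where [ast] vanishes, [a <= 0] and hence [lap u] is bounded above, so the
    Harnack estimate carries a large maximum to a vertex where [ast], and
    therefore [a], is bounded away from 0.  There the exponential of the
    maximum is balanced only by [lap u], which grows linearly.  Allowing [a] to
    approach [ast] from below, and only from below, is what the limit at the
    largest parameter needs: a small positive [a] would not be controlled. *)
Lemma residual_upper_bound k (ast : V -> R) (B : R) :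
  (exists z, ast z != 0) -> exists delta M : R, 0 < delta /\
  forall a u, (forall x, ast x - delta <= a x <= ast x) ->
    (forall x, - B <= u x) -> (forall x, `|residual k a u x| <= 1) ->
    forall x, u x <= M.
Proof.
move=> [z astz].
have [|alpha alpha0 alphaP] :=
  @pos_lower_bound R V (fun x => if ast x == 0 then 1 else `|ast x| / 2).
  by move=> x; case: eqVneq => // ax; rewrite divr_gt0 // normr_gt0.
pose C := \sum_x `|k x| + 1.
have C0 : 0 <= C by rewrite addr_ge0 // sumr_ge0.
have [r r0 harnack] := lap_harnack C0.
pose W := \sum_x \sum_(y | e x y) w x y.
have WP x : 0 <= \sum_(y | e x y) w x y <= W.
  have Wx y : 0 <= \sum_(z | e y z) w y z by apply: sumr_ge0 => ? /w_gt0 /ltW.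
  by rewrite Wx /W [leRHS](bigD1 x) //= lerDl sumr_ge0.
have [M HM] := expR_le_affine r W (W * B + C) alpha0.
exists alpha, M; split => // a u aP uB resu x.
case: (@Order.TotalTheory.arg_maxP _ _ _ x xpredT u) => // x0 _ ux0.
apply: le_trans (ux0 x isT) _; apply: HM.
have [//|||y /eqP asty uy] := harnack u (fun y => ast y = 0) x0 z.
- by move=> y; exact: ux0.
- move=> y asty; have := resu y; rewrite ler_norml /residual => /andP[_].
  have /andP[_] := aP y; rewrite asty => ay.
  have := ler_sum_norm (fun x => - k x) y.
  under eq_bigr do rewrite normrN.
  have : a y * expR (2 * u y) <= 0 by rewrite mulr_le0_ge0 // expR_ge0.
  rewrite /C; lra.
- exact/eqP.
have alpha_a : alpha <= `|a y|.
  have := alphaP y; rewrite (negbTE asty); have /andP[ay1 ay2] := aP y.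
  have [a_pos|a_neg] := ltP 0 (ast y).
    by rewrite (gtr0_norm a_pos) => h; rewrite ger0_norm; lra.
  by rewrite (ler0_norm a_neg) => h; rewrite ler0_norm; lra.
have : alpha * expR (2 * (u x0 - r)) <= `|a y * expR (2 * u y)|.
  rewrite normrM (ger0_norm (expR_ge0 _)) ler_pM ?expR_ge0 ?(ltW alpha0) //.
  rewrite ler_expR; lra.
move=> /le_trans; apply.
have -> : a y * expR (2 * u y) = lap u y + k y - residual k a u y.
  by rewrite /residual; lra.
have range y' : - B <= u y' <= u x0 by rewrite uB; exact: ux0.
have := lap_le_range y range.
have := ler_normB (lap u y + k y) (residual k a u y).
have := ler_normD (lap u y) (k y).
have := normr_le_sum k y; have := resu y.
have /andP[W0 WW] := WP y; have /andP[? ?] := range x0.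
rewrite /C; nra.
Qed.

(** The difference [d] of two solutions satisfies
    [lap d = a * (expR (2 * u) - expR (2 * v))], so [d * lap d <= 0] pointwise
    while its sum is nonnegative.  Hence [d] is constant along edges, and it
    vanishes where [a] does not. *)
Lemma residual_unique k a u v : (forall x, a x <= 0) -> (exists z, a z != 0) ->
  (forall x, residual k a u x = 0) -> (forall x, residual k a v x = 0) ->
  u = v.
Proof.
move=> a_le0 [z az] ru rv; pose d x := u x - v x.
have lapd x : lap d x = a x * (expR (2 * u x) - expR (2 * v x)).
  have -> : lap d x = lap u x + -1 * lap v x.
    by rewrite -lap_lincomb; congr lap; apply/funext => y; rewrite /d mulN1r.
  by move: (ru x) (rv x); rewrite /residual; lra.
have mono (s t : R) : 0 <= (s - t) * (expR (2 * s) - expR (2 * t)).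
  have [st|ts] := leP s t.
    by rewrite mulr_le0 // subr_le0 // ler_expR; lra.
  by rewrite mulr_ge0 // subr_ge0 ?ler_expR; lra.
have term x : d x * lap d x <= 0 by rewrite lapd /d mulrCA; have := mono (u x) (v x); have := a_le0 x; nra.
have sum0 : \sum_x d x * lap d x = 0.
  by apply/eqP; rewrite eq_le lap_nonneg // andbT sumr_le0.
have dz : d z = 0.
  have /eqP : d z * lap d z = 0.
    have /eqP := sum0; rewrite -oppr_eq0 -sumrN psumr_eq0.
      by move=> /allP/(_ z); rewrite mem_index_enum => /(_ isT) /=; rewrite oppr_eq0 => /eqP.
    by move=> x _; rewrite oppr_ge0.
  rewrite lapd mulf_eq0 mulf_eq0 (negbTE az) /= => /orP[/eqP//|].
  by rewrite subr_eq0 => /eqP/expR_inj; rewrite /d; lra.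
have edge x y : e x y -> d x = d y.
  move=> exy; have /eqP := sum0.
  rewrite lap_green // mulf_eq0 invr_eq0 pnatr_eq0 /= psumr_eq0; last first.
    move=> x' _; apply: sumr_ge0 => y' /w_gt0 /ltW wxy.
    by rewrite mulr_ge0 // -expr2 sqr_ge0.
  move=> /allP/(_ x); rewrite mem_index_enum => /(_ isT) /=.
  rewrite psumr_eq0; last first.
    by move=> y' /w_gt0 /ltW wxy; rewrite mulr_ge0 // -expr2 sqr_ge0.
  move=> /allP/(_ y); rewrite mem_index_enum => /(_ isT); rewrite exy /=.
  by rewrite mulf_eq0 gt_eqF ?w_gt0 //= mulf_eq0 orbb subr_eq0 => /eqP.
apply/funext => x; suff : d x = 0 by rewrite /d; lra.
have /connectP[p] := V_conn x z; elim: p x => [|y p IH] x /=; first by move=> _ <-.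
by move=> /andP[/edge -> yp] zE; exact: IH.
Qed.

(** * The energy and its gradient steps *)

Definition energy k a u : R := 2^-1 * (\sum_x u x * lap u x)
  + \sum_x k x * u x - 2^-1 * \sum_x a x * expR (2 * u x).

(** A majorant of half the second derivative of the energy in the direction
    [d], valid on short segments. *)
Definition second_order a u d : R := 2^-1 * (\sum_x d x * lap d x)
  + 4 * \sum_x `|a x| * expR (2 * u x) * d x ^+ 2.

Lemma second_order_ge0 a u d : 0 <= second_order a u d.
Proof.
rewrite addr_ge0 ?mulr_ge0 ?lap_nonneg // sumr_ge0 // => x _.
by rewrite mulr_ge0 ?sqr_ge0 // mulr_ge0 ?expR_ge0.
Qed.

Lemma dirichlet_shift u d (s : R) :
  \sum_x (u x + s * d x) * lap (fun x => u x + s * d x) x =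
  \sum_x u x * lap u x + 2 * s * (\sum_x lap u x * d x)
    + s ^+ 2 * \sum_x d x * lap d x.
Proof.
under eq_bigr do rewrite lap_lincomb.
have -> : 2 * s * (\sum_x lap u x * d x) =
    s * (\sum_x d x * lap u x) + s * (\sum_x u x * lap d x).
  rewrite -(lap_selfadjoint d u).
  have -> : \sum_x lap u x * d x = \sum_x d x * lap u x.
    by apply: eq_bigr => x _; rewrite mulrC.
  by ring.
by rewrite !mulr_sumr -!big_split /=; apply: eq_bigr => x _; ring.
Qed.

Lemma energy_expansion k a u d (s : R) : (forall x, `|2 * s * d x| <= 1 / 2) ->
  energy k a (fun x => u x + s * d x) <=
  energy k a u + s * (\sum_x residual k a u x * d x) + s ^+ 2 * second_order a u d.
Proof.
move=> sd; have potential : - (\sum_x a x * expR (2 * (u x + s * d x))) <=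
    - (\sum_x a x * expR (2 * u x)) - 2 * s * (\sum_x a x * expR (2 * u x) * d x)
    + 8 * s ^+ 2 * \sum_x `|a x| * expR (2 * u x) * d x ^+ 2.
  rewrite !mulr_sumr -!sumrN -!big_split /=; apply: ler_sum => x _.
  have -> : 2 * (u x + s * d x) = 2 * u x + 2 * s * d x by ring.
  rewrite expRD; have := expR_quadratic (sd x).
  set y := 2 * s * d x; set E := expR (2 * u x) => q.
  have E0 : 0 <= E by exact: expR_ge0.
  have : `|a x * E * (expR y - 1 - y)| <= `|a x| * E * (2 * y ^+ 2).
    by rewrite 2!normrM (ger0_norm E0) ler_wpM2l // mulr_ge0.
  rewrite ler_norml => /andP[+ _].
  have -> : 8 * s ^+ 2 * (`|a x| * E * d x ^+ 2) = `|a x| * E * (2 * y ^+ 2).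
    by rewrite /y; ring.
  rewrite /y; lra.
rewrite /energy dirichlet_shift /second_order.
have -> : \sum_x k x * (u x + s * d x) = \sum_x k x * u x + s * \sum_x k x * d x.
  by rewrite mulr_sumr -big_split /=; apply: eq_bigr => x _; ring.
have -> : \sum_x residual k a u x * d x = \sum_x lap u x * d x
    + \sum_x k x * d x - \sum_x a x * expR (2 * u x) * d x.
  by rewrite -sumrN -!big_split /=; apply: eq_bigr => x _; rewrite /residual; ring.
move: potential; set X := \sum_x _ * expR (2 * (_ + _)).
set Y := \sum_x `|_| * _ * _.
set Z := \sum_x a x * expR _ * d x; set D := \sum_x d x * _.
rewrite expr2; nra.
Qed.

(** A short enough step makes the first-order term dominate. *)
Lemma energy_descent_direction k a u d (eps : R) :
  \sum_x residual k a u x * d x < 0 -> 0 < eps ->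
  exists2 s, 0 < s <= eps & energy k a (fun x => u x + s * d x) < energy k a u.
Proof.
set g := \sum_x _ => g0 eps0; have H0 := second_order_ge0 a u d.
set H := second_order a u d in H0.
have D0 : 0 <= \sum_x `|d x| by apply: sumr_ge0.
pose s := Num.min eps (Num.min (4 * (1 + \sum_x `|d x|))^-1 (- g / (1 + H) / 2)).
have s0 : 0 < s.
  by rewrite !lt_min eps0 invr_gt0 !divr_gt0 ?oppr_gt0 //; lra.
exists s; first by rewrite s0 ge_min lexx.
have sD : s * (4 * (1 + \sum_x `|d x|)) <= 1.
  rewrite -ler_pdivlMr; last lra.
  by rewrite /s div1r !ge_min lexx ?orbT.
have sH : s * (1 + H) <= - g / 2.
  rewrite -ler_pdivlMr; last lra.
  by rewrite /s (_ : - g / 2 / (1 + H) = - g / (1 + H) / 2) ?ge_min ?lexx ?orbT // mulrAC.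
apply: le_lt_trans (energy_expansion _ _ _ _) _.
  move=> x; rewrite -mulrA 2!normrM (ger0_norm (ltW s0)) ger0_norm //.
  have := normr_le_sum d x; nra.
rewrite -/g -/H expr2; nra.
Qed.

Lemma continuous_lap x : continuous (fun u : V -> R => lap u x).
Proof.
apply: continuous_sumf => y; apply: continuous_mulf; first exact: cst_continuous.
by apply: continuous_addf; [|apply: continuous_oppf]; exact: continuous_eval.
Qed.

Lemma continuous_exp2 x : continuous (fun u : V -> R => expR (2 * u x)).
Proof.
apply: continuous_expf; apply: continuous_mulf; first exact: cst_continuous.
exact: continuous_eval.
Qed.

Lemma continuous_residual k a x : continuous (fun u : V -> R => residual k a u x).
Proof.
apply: continuous_addf; first apply: continuous_addf.
- exact: continuous_lap.
- exact: cst_continuous.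
- apply: continuous_oppf; apply: continuous_mulf; first exact: cst_continuous.
  exact: continuous_exp2.
Qed.

Lemma continuous_energy k a : continuous (energy k a).
Proof.
apply: continuous_addf; first apply: continuous_addf.
- apply: continuous_mulf; first exact: cst_continuous.
  apply: continuous_sumf => x; apply: continuous_mulf; first exact: continuous_eval.
  exact: continuous_lap.
- apply: continuous_sumf => x; apply: continuous_mulf; first exact: cst_continuous.
  exact: continuous_eval.
- apply: continuous_oppf; apply: continuous_mulf; first exact: cst_continuous.
  apply: continuous_sumf => x; apply: continuous_mulf; first exact: cst_continuous.
  exact: continuous_exp2.
Qed.

(** The first-order conditions: from a minimizer a coordinate may be moved
    downwards where it exceeds the lower wall, upwards where it is below the
    upper wall. *)
Lemma box_minimizer_residual k a lo hi u : (forall x, lo x <= u x <= hi x) ->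
  (forall v, (forall x, lo x <= v x <= hi x) -> energy k a u <= energy k a v) ->
  (forall x, lo x < u x -> residual k a u x <= 0) /\
  (forall x, u x < hi x -> 0 <= residual k a u x).
Proof.
move=> ubox umin.
have coord x (c : R) : \sum_y residual k a u y * (if y == x then c else 0)
    = residual k a u x * c.
  rewrite (bigD1 x) //= eqxx big1 ?addr0 // => y /negbTE ->.
  by rewrite mulr0.
have inward x (c eps : R) : residual k a u x * c < 0 -> 0 < eps ->
    (forall s, 0 < s <= eps -> lo x <= u x + s * c <= hi x) -> False.
  move=> res_c eps0 room.
  have [|s s_eps] := @energy_descent_direction k a u
    (fun y => if y == x then c else 0) eps _ eps0; first by rewrite coord.
  apply/negP; rewrite -leNgt; apply: umin => y.
  by case: eqVneq => [->|_]; [exact: room|rewrite mulr0 addr0; exact: ubox].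
split=> x ux; rewrite leNgt; apply/negP => res0; have /andP[lox xhi] := ubox x.
- apply: (inward x (-1) (u x - lo x)); [lra|lra|].
  by move=> s /andP[? ?]; apply/andP; split; lra.
- apply: (inward x 1 (hi x - u x)); [lra|lra|].
  by move=> s /andP[? ?]; apply/andP; split; lra.
Qed.

Lemma energy_box_minimizer k a lo hi : (forall x, lo x <= hi x) ->
  exists2 u, forall x, lo x <= u x <= hi x &
    forall v, (forall x, lo x <= v x <= hi x) -> energy k a u <= energy k a v.
Proof.
move=> lohi; have [|//|u ubox umin] := @box_argmin R V _ _ lo hi
  (@continuous_energy k a) (@closed_box R V lo hi); last by exists u.
by exists lo => x /=; rewrite lexx lohi.
Qed.

Definition slope k a u : R := \sum_x residual k a u x ^+ 2.

(** The denominator of the step length: the second term makes the quadratic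
    error at most half of the first-order gain, the third keeps the
    displacement in the range of [expR_quadratic]. *)
Definition stiffness k a u : R :=
  1 + 2 * second_order a u (fun x => - residual k a u x)
  + 4 * slope k a u * \sum_x `|- residual k a u x|.

Definition step k a u : R := slope k a u / stiffness k a u.

Lemma slope_ge0 k a u : 0 <= slope k a u.
Proof. by apply: sumr_ge0 => x _; exact: sqr_ge0. Qed.

Lemma continuous_slope k a : continuous (slope k a).
Proof.
apply: continuous_sumf => x.
by apply: continuous_mulf; exact: continuous_residual.
Qed.

Lemma stiffness_gt0 k a u : 0 < stiffness k a u.
Proof.
have H0 := second_order_ge0 a u (fun x => - residual k a u x).
have D0 : 0 <= \sum_x `|- residual k a u x| by apply: sumr_ge0.
have := mulr_ge0 (slope_ge0 k a u) D0; rewrite /stiffness; lra.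
Qed.

Lemma continuous_step k a : continuous (step k a).
Proof.
have dc x : continuous (fun u : V -> R => - residual k a u x).
  by apply: continuous_oppf; exact: continuous_residual.
apply: continuous_mulf; first exact: continuous_slope.
apply: continuous_invf => [u|]; first exact: lt0r_neq0 (stiffness_gt0 k a u).
apply: continuous_addf.
  apply: continuous_addf; first exact: cst_continuous.
  apply: continuous_mulf; first exact: cst_continuous.
  apply: continuous_addf; apply: continuous_mulf; try exact: cst_continuous.
    apply: continuous_sumf => x; apply: continuous_mulf; first exact: dc.
    apply: continuous_sumf => y; apply: continuous_mulf; first exact: cst_continuous.
    by apply: continuous_addf; [|apply: continuous_oppf]; exact: dc.
  apply: continuous_sumf => x; apply: continuous_mulf.
    apply: continuous_mulf; first exact: cst_continuous.
    exact: continuous_exp2.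
  by apply: continuous_mulf; exact: dc.
apply: continuous_mulf.
  apply: continuous_mulf; first exact: cst_continuous.
  exact: continuous_slope.
by apply: continuous_sumf => x; apply: continuous_normf; exact: dc.
Qed.

Lemma energy_descent k a u (s : R) : 0 <= s <= step k a u ->
  energy k a (fun x => u x + s * - residual k a u x) <=
  energy k a u - s / 2 * slope k a u.
Proof.
pose d x := - residual k a u x.
have den := stiffness_gt0 k a u; move=> /andP[s0].
rewrite /step ler_pdivlMr // /stiffness -/d; set H := second_order _ _ _.
set D := \sum_x _; set G := slope k a u => sG.
have H0 : 0 <= H by exact: second_order_ge0.
have G0 : 0 <= G by exact: slope_ge0.
have D0 : 0 <= D by apply: sumr_ge0.
have gd : \sum_x residual k a u x * d x = - G.
  by rewrite -sumrN; apply: eq_bigr => x _; rewrite /d; ring.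
have sH0 := mulr_ge0 s0 H0; have sGD := mulr_ge0 s0 (mulr_ge0 G0 D0).
have sH : s * (2 * H) <= G by lra.
apply: le_trans (energy_expansion _ _ _ _) _; last first.
  rewrite -/d gd -/H expr2; nra.
move=> x; rewrite -/(d x) -mulrA 2!normrM (ger0_norm s0) ger0_norm //.
have dD : s * `|d x| <= s * D by rewrite ler_wpM2l // normr_le_sum.
suff : 4 * (s * D) <= 1 by lra.
have [Gpos|G_le0] := ltP 0 G; last by rewrite (_ : s = 0) ?mul0r ?mulr0 //; lra.
by rewrite -(ler_pM2l Gpos); lra.
Qed.

(** * Supersolutions and second solutions *)

Lemma slope_eq0 k a u : slope k a u = 0 -> forall x, residual k a u x = 0.
Proof.
move=> /eqP; rewrite psumr_eq0 => [/allP h x|x _]; last exact: sqr_ge0.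
by have := h x; rewrite mem_index_enum sqrf_eq0 => /(_ isT) /eqP.
Qed.

(** Minimize between a far lower wall and [v].  At a contact with [v] the
    comparison principle makes the residual at least that of [v], while the
    first-order condition makes it nonpositive, so there is no contact where
    [v] is strict.  The lower wall is never
    reached because a function with nonnegative residual obeys
    [residual_lower_bound]. *)
Lemma supersolution_minimizer k a v : \sum_x k x < 0 ->
  (forall x, 0 <= residual k a v x) ->
  exists lo u, [/\ forall x, lo x < u x <= v x,
    forall x, 0 < residual k a v x -> u x < v x,
    forall x, residual k a u x = 0
  & forall u', (forall x, lo x <= u' x <= v x) -> energy k a u <= energy k a u'].
Proof.
move=> k_lt0 sup_v; have A0 : 0 <= \sum_x `|a x| by apply: sumr_ge0.
have [eps [B [eps0 lower]]] := residual_lower_bound k_lt0 A0.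
have {}lower u' : (forall x, 0 <= residual k a u' x) -> forall x, - B <= u' x.
  move=> h; apply: lower => x; [exact: normr_le_sum|].
  by apply: le_trans (h x); lra.
have vB := lower _ sup_v.
have [|u ubox umin] := energy_box_minimizer k a
  (lo := fun=> - B - 1) (hi := v).
  by move=> x; have := vB x; lra.
have [res_le0 res_ge0] := box_minimizer_residual ubox umin.
have contact x : u x = v x -> residual k a v x <= residual k a u x.
  move=> uvx; rewrite /residual uvx 2!lerD2r.
  by apply: (lap_touch) uvx => y; have /andP[] := ubox y.
have ru x : 0 <= residual k a u x.
  have /andP[_ uvx] := ubox x; have [/res_ge0//|vux] := ltP (u x) (v x).
  by apply: le_trans (sup_v x) (contact x _); apply/eqP; rewrite eq_le uvx.
have lou x : - B - 1 < u x by have := lower _ ru x; lra.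
have ru0 x : residual k a u x = 0.
  by apply/eqP; rewrite eq_le ru res_le0.
exists (fun=> - B - 1), u; split=> // x.
- by rewrite lou; have /andP[] := ubox x.
- move=> rv; have /andP[_ uvx] := ubox x; rewrite lt_neqAle uvx andbT.
  by apply/eqP => /contact; rewrite ru0 leNgt rv.
Qed.

(** Solve [lap h = 1] off [x1] with [h x1 = 0], as the minimizer of
    [1/2 sum h lap h - sum h] between 0 and a high ceiling.  Wherever the
    ceiling is not reached, the first-order condition gives [1 <= lap h]; and
    if it were reached, the Harnack estimate would make [h x1] positive. *)
Lemma lap_ge1_off_point x1 : exists h : V -> R, forall x, x != x1 -> 1 <= lap h x.
Proof.
have [r r0 harnack] := lap_harnack (ler01 : 0 <= 1 :> R).
pose hi x : R := if x == x1 then 0 else r + 1.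
(* With [k = -1] and [a = 0] the residual is [lap h - 1]; the box is degenerate at
   [x1], which imposes [h x1 = 0]. *)
have [|h hbox hmin] := energy_box_minimizer
  (fun=> -1) (fun=> 0) (lo := fun=> 0) (hi := hi).
  by move=> x; rewrite /hi; case: ifP => // _; lra.
have [res_le0 res_ge0] := box_minimizer_residual hbox hmin.
have resE x : residual (fun=> -1) (fun=> 0) h x = lap h x - 1.
  by rewrite /residual mul0r subr0.
have h_le x : h x <= r + 1.
  have /andP[_] := hbox x; rewrite /hi; case: ifP => // _; lra.
exists h => x xx1.
have [hx|hx] := ltP (h x) (r + 1).
  by have := res_ge0 x; rewrite /hi (negbTE xx1) resE hx => /(_ isT); lra.
exfalso; have [|||y] := harnack h (fun y => y != x1) x x1.
- by move=> y; apply: le_trans hx.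
- move=> y _; have /andP[h0 _] := hbox y; have [hy|hy] := ltP 0 (h y).
    by have := res_le0 y hy; rewrite resE; lra.
  apply: le_trans (_ : lap (fun=> 0) y <= 1); last by rewrite lap_const ler01.
  apply: (lap_touch) => [z|]; first by have /andP[] := hbox z.
  by apply/eqP; rewrite eq_le h0.
- by rewrite eqxx.
move=> /negP; rewrite negbK => /eqP ->.
by have /andP[_] := hbox x1; rewrite /hi eqxx; lra.
Qed.

(** A large multiple of the function of [lap_ge1_off_point] makes [lap u + k]
    positive off [x1]; adding a large constant makes the term
    [- b x1 * expR (2 * u x1)] win at [x1].  The residual for [lam = 0] is then
    at least 1, which leaves room for a small [lam]. *)
Lemma small_supersolution k (b m : V -> R) x1 : (forall x, b x <= 0) -> b x1 < 0 ->
  (forall x, 0 < m x) -> exists2 lam : R, 0 < lam &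
  exists u, forall x, 0 <= residual k (fun x => b x + m x * lam) u x.
Proof.
move=> b_le0 bx1 m0; have [h hP] := lap_ge1_off_point x1.
pose A := 1 + \sum_x `|k x|.
have A0 : 0 < A by rewrite ltr_pwDl // sumr_ge0.
pose Y := (1 + `|A * lap h x1 + k x1|) / - b x1.
pose u x := (Y - A * h x1) + A * h x.
have lapu x : lap u x = A * lap h x.
  by rewrite (lap_lincomb (fun=> _) h) lap_const add0r.
have res0 x : 1 <= residual k b u x.
  rewrite /residual lapu; have [->|xx1] := eqVneq x x1.
    have -> : 2 * u x1 = 2 * Y by rewrite /u; ring.
    have Y0 : 0 <= Y by rewrite divr_ge0 ?addr_ge0 //; lra.
    have Yb : Y * - b x1 = 1 + `|A * lap h x1 + k x1|.
      by rewrite /Y divfK // oppr_eq0 lt_eqF.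
    have Yexp : Y <= expR (2 * Y) by have := expR_ge1Dx (2 * Y); lra.
    have : Y * - b x1 <= expR (2 * Y) * - b x1 by rewrite ler_wpM2r //; lra.
    have := ler_norm (- (A * lap h x1 + k x1)); rewrite normrN Yb; lra.
  have : A * 1 <= A * lap h x by rewrite ler_wpM2l ?(ltW A0) ?hP.
  have := mulr_le0_ge0 (b_le0 x) (expR_ge0 (2 * u x)).
  have := ler_sum_norm (fun x => - k x) x; under eq_bigr do rewrite normrN.
  rewrite /A; lra.
have E0 : 0 <= \sum_x `|m x * expR (2 * u x)| by apply: sumr_ge0.
exists (1 + \sum_x `|m x * expR (2 * u x)|)^-1; first by rewrite invr_gt0; lra.
exists u => x; have := res0 x; rewrite /residual.
have := ler_sum_norm (fun x => m x * expR (2 * u x)) x.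
set S := \sum_x _ in E0 *; move=> mS.
have : m x * expR (2 * u x) * (1 + S)^-1 <= 1 by rewrite ler_pdivrMr; lra.
lra.
Qed.

Lemma energy_bump k a u x0 (T : R) : let d y : R := (y == x0)%:R in
  energy k a (fun y => u y + T * d y) = energy k a u + T * (lap u x0 + k x0)
  + T ^+ 2 / 2 * (\sum_y d y * lap d y)
  - a x0 * expR (2 * u x0) * (expR (2 * T) - 1) / 2.
Proof.
move=> d; rewrite /energy dirichlet_shift //.
have pick f : \sum_y f y * d y = f x0.
  rewrite (bigD1 x0) //= /d eqxx mulr1 big1 ?addr0 // => y /negbTE ->.
  by rewrite mulr0.
have -> : \sum_x k x * (u x + T * d x) = \sum_x k x * u x + T * k x0.
  rewrite -(pick k) mulr_sumr -big_split /=.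
  by apply: eq_bigr => y _; ring.
have -> : \sum_x a x * expR (2 * (u x + T * d x)) = \sum_x a x * expR (2 * u x)
    + a x0 * expR (2 * u x0) * (expR (2 * T) - 1).
  rewrite -(pick (fun x => a x * expR (2 * u x) * (expR (2 * T) - 1))) -big_split /=.
  apply: eq_bigr => y _; rewrite /d; case: eqVneq => _ /=; last by rewrite !mulr0 !addr0.
  by rewrite !mulr1 mulrDr expRD; ring.
by rewrite (pick (lap u)); field.
Qed.

(** Along the coordinate [x0] the energy is a quadratic polynomial minus a
    positive multiple of [expR (2 * T)]. *)
Lemma energy_unbounded_below k a u x0 (r : R) : 0 < a x0 -> exists T : R, r < T /\
  energy k a (fun y => u y + T * (y == x0)%:R) <= energy k a u.
Proof.
move=> a0; pose d y : R := (y == x0)%:R.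
pose p := lap u x0 + k x0; pose q := (\sum_y d y * lap d y) / 2.
pose c := a x0 * expR (2 * u x0) / 4.
have c0 : 0 < c by rewrite divr_gt0 // mulr_gt0 // expR_gt0.
pose T := 1 + `|r| + (`|p| + `|q|) / c.
have X0 : 0 <= (`|p| + `|q|) / c by rewrite divr_ge0 ?(ltW c0) ?addr_ge0.
have T1 : 1 <= T by have := normr_ge0 r; rewrite /T; lra.
exists T; split; first by have := ler_norm r; rewrite /T; lra.
rewrite energy_bump -/d -/p.
have cT : `|p| + `|q| <= c * T.
  rewrite mulrC -ler_pdivrMr // /T; have := normr_ge0 r; lra.
have e4 : T ^+ 4 / 2 <= expR (2 * T) - 1.
  have := @expR_ge1Dxn R (2 * T) 3; rewrite (_ : 4`! = 24%N) // exprMn.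
  have T4 : 0 <= T ^+ 4 by rewrite exprn_ge0 //; lra.
  by move=> /(_ ltac:(lra)); lra.
have drop : c * T ^+ 4 <= a x0 * expR (2 * u x0) * (expR (2 * T) - 1) / 2.
  have : 4 * c * (T ^+ 4 / 2) <= 4 * c * (expR (2 * T) - 1).
    by rewrite ler_wpM2l //; lra.
  by rewrite /c; lra.
have gain : T * p + T ^+ 2 * q <= c * T ^+ 4.
  have T2 : T <= T ^+ 2 by rewrite expr2; nra.
  have T20 : 0 <= T ^+ 2 by exact: sqr_ge0.
  apply: (@le_trans _ _ (T ^+ 2 * (`|p| + `|q|))).
    by have := ler_norm p; have := ler_norm q; have := normr_ge0 p; nra.
  apply: (@le_trans _ _ (T ^+ 2 * (c * T ^+ 2))).
    rewrite ler_wpM2l //; apply: le_trans cT _; rewrite ler_wpM2l //; lra.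
  by rewrite mulrCA -exprD.
rewrite /q in gain; lra.
Qed.

(** The Palais-Smale condition: small residuals satisfy the hypotheses of both
    bounds for approximate solutions. *)
Lemma small_slope_bounded k a : \sum_x k x < 0 -> (exists z, a z != 0) ->
  exists delta B : R, 0 < delta /\
    forall u, slope k a u <= delta -> forall x, - B <= u x <= B.
Proof.
move=> k_lt0 az; have A0 : 0 <= \sum_x `|a x| by apply: sumr_ge0.
have [eps [B [eps0 lower]]] := residual_lower_bound k_lt0 A0.
have [eta [M [eta0 upper]]] := residual_upper_bound k B az.
exists (Num.min eps 1 ^+ 2), (`|B| + `|M|).
have m0 : 0 < Num.min eps 1 by rewrite lt_min eps0 ltr01.
split; first by rewrite exprn_gt0.
move=> u small.
have res x : `|residual k a u x| <= Num.min eps 1.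
  rewrite -(@ler_pXn2r _ 2) ?nnegrE ?(ltW m0) // real_normK ?num_real //.
  apply: le_trans small; rewrite /slope (bigD1 x) //= lerDl.
  by apply: sumr_ge0 => y _; exact: sqr_ge0.
have uB : forall x, - B <= u x.
  apply: lower => x; first exact: normr_le_sum.
  have := res x; rewrite ler_norml le_min => /andP[h _].
  by apply: le_trans h; rewrite lerN2 ge_min lexx.
have uM : forall x, u x <= M.
  apply: (upper a) => // x.
    by rewrite lexx andbT; lra.
  by apply: le_trans (res x) _; rewrite ge_min lexx orbT.
move=> x; have := uB x; have := uM x; have := ler_norm B; have := ler_norm M.
have := normr_ge0 B; have := normr_ge0 M => *; apply/andP; split; lra.
Qed.

(** The minimizer [u0] below the strict supersolution [v] lies in the interior
    of a box on which it minimizes the energy.  Compare it with the minimum of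
    the energy over a small sphere inside the box: if the values agree, the
    minimum point is interior too and solves the equation; if not, the sphere
    is a ridge around [u0], and [mountain_pass] applies. *)
Lemma two_solutions k a v x0 : \sum_x k x < 0 -> 0 < a x0 ->
  (forall x, 0 < residual k a v x) ->
  exists u1 u2, [/\ u1 <> u2, forall x, residual k a u1 x = 0
    & forall x, residual k a u2 x = 0].
Proof.
move=> k_lt0 ax0 strict.
have [lo [u0 [lou uv res0 umin]]] :=
  supersolution_minimizer k_lt0 (fun x => ltW (strict x)).
have {}uv x : u0 x < v x by exact: uv.
have {}lou x : lo x < u0 x by have /andP[] := lou x.
have [|r r0 room] := @pos_lower_bound R V (fun x => Num.min (u0 x - lo x) (v x - u0 x) / 2).
  by move=> x; rewrite divr_gt0 // lt_min !subr_gt0 lou uv.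
have {}room u' x : u0 x - r <= u' x <= u0 x + r -> lo x < u' x < v x.
  have := room x; rewrite ler_pdivlMr // le_min => /andP[? ?] /andP[? ?].
  by apply/andP; split; lra.
pose rho u := \sum_x (u x - u0 x) ^+ 2 - r ^+ 2.
have rho_cont : continuous rho.
  apply: continuous_addf; last exact: cst_continuous.
  apply: continuous_sumf => x.
  by apply: continuous_mulf; apply: continuous_addf;
    [exact: continuous_eval|exact: cst_continuous|exact: continuous_eval|exact: cst_continuous].
have rho_bump T : rho (fun y => u0 y + T * (y == x0)%:R) = T ^+ 2 - r ^+ 2.
  rewrite /rho (bigD1 x0) //= eqxx mulr1 big1 ?addr0; last first.
    by move=> y /negbTE ->; rewrite mulr0 addr0 subrr expr0n.
  by rewrite addrAC subrr add0r.
have near u : rho u = 0 -> forall x, u0 x - r <= u x <= u0 x + r.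
  move=> /eqP; rewrite subr_eq0 => /eqP ur x.
  have : `|u x - u0 x| <= r.
    rewrite -(@ler_pXn2r _ 2) ?nnegrE ?(ltW r0) // real_normK ?num_real // -ur.
    by rewrite (bigD1 x) //= lerDl; apply: sumr_ge0 => y _; exact: sqr_ge0.
  by rewrite ler_norml => /andP[? ?]; apply/andP; split; lra.
have [|u1 rho1 u1min] := @box_argmin R V _ _ _ _ (@continuous_energy k a)
  (@closed_level _ _ _ rho_cont 0) _ near.
  by exists (fun y => u0 y + r * (y == x0)%:R); rewrite /= rho_bump subrr.
have rho0 : rho u0 < 0.
  by rewrite /rho big1 ?add0r ?oppr_lt0 ?exprn_gt0 // => x _; rewrite subrr expr0n.
have u1box x : lo x < u1 x < v x by apply: room; exact: near.
have u1box' x : lo x <= u1 x <= v x by have /andP[/ltW -> /ltW ->] := u1box x.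
have := umin _ u1box'; rewrite le_eqVlt => /orP[/eqP flat|ridge].
  rewrite flat in umin.
  have [le0 ge0] := box_minimizer_residual u1box' umin.
  exists u0, u1; split=> //.
    by move=> u01; move: rho0; rewrite u01 rho1 ltxx.
  move=> x; have /andP[? ?] := u1box x.
  by apply/eqP; rewrite eq_le le0 // ge0.
have [delta [B [delta0 bounded]]] := small_slope_bounded k_lt0 (ex_intro _ x0 (lt0r_neq0 ax0)).
have [T [rT farT]] := energy_unbounded_below k u0 r ax0.
have step_ge0 u : 0 <= step k a u.
  by rewrite divr_ge0 ?slope_ge0 // ltW // stiffness_gt0.
have step_gt0 u : 0 < slope k a u -> 0 < step k a u.
  by move=> s0; rewrite divr_gt0 // stiffness_gt0.
have dir_cont x : continuous (fun u => - residual k a u x).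
  by apply: continuous_oppf; exact: continuous_residual.
have dir_le u x : (- residual k a u x) ^+ 2 <= slope k a u.
  rewrite sqrrN /slope (bigD1 x) //= lerDl.
  by apply: sumr_ge0 => y _; exact: sqr_ge0.
have barrier u : rho u = 0 -> energy k a u1 <= energy k a u by exact: u1min.
have far_out : 0 < rho (fun y => u0 y + T * (y == x0)%:R).
  by rewrite rho_bump subr_gt0 ltr_pXn2r // ?nnegrE ltW // (lt_trans r0).
have [u2 /slope_eq0 res2 high] := mountain_pass
  (@continuous_energy k a) rho_cont (@continuous_slope k a)
  (@continuous_step k a) dir_cont step_ge0 step_gt0
  (@energy_descent k a) dir_le (slope_ge0 k a)
  delta0 bounded barrier ridge rho0 (le_lt_trans farT ridge) far_out.
by exists u0, u2; split=> // u02; move: ridge; rewrite u02 ltNge high.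
Qed.

(** * The set of solvable parameters *)

Section Threshold.
Variables (k b m : V -> R).
Hypothesis k_lt0 : \sum_x k x < 0.
Hypothesis m_gt0 : forall x, 0 < m x.
Implicit Types (lam : R).
Local Notation res lam := (residual k (fun x => b x + m x * lam)).

Definition solvable lam := exists u, forall x, res lam u x = 0.

Lemma residual_shift lam lam' u x :
  res lam u x = res lam' u x + m x * expR (2 * u x) * (lam' - lam).
Proof. by rewrite /residual; ring. Qed.

(** Lowering the parameter raises the residual, so a solution becomes a
    supersolution. *)
Lemma solvable_downward lam lam' : lam <= lam' -> solvable lam' -> solvable lam.
Proof.
move=> ll [v rv]; have [|_ [u [_ _ ru _]]] :=
  @supersolution_minimizer k
    (fun x => b x + m x * lam) v k_lt0; last by exists u.
move=> x; rewrite (residual_shift lam lam') rv add0r.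
by rewrite mulr_ge0 ?subr_ge0 // mulr_ge0 ?expR_ge0 // ltW.
Qed.

(** Solutions for parameters slightly below [lams] lie in a fixed box, and
    their slopes for the parameter [lams] are arbitrarily small; so the minimum
    of this slope over the box is 0. *)
Lemma solvable_closed lams : (exists z, b z + m z * lams != 0) ->
  (forall eta, 0 < eta -> exists2 lam, lams - eta < lam <= lams & solvable lam) ->
  solvable lams.
Proof.
move=> nz approx; pose ast x := b x + m x * lams.
pose A := \sum_x `| `|b x| + m x * (`|lams| + 1)|.
have A0 : 0 <= A by apply: sumr_ge0.
have [eps [B [eps0 lower]]] := residual_lower_bound k_lt0 A0.
have [delta [M [delta0 upper]]] := residual_upper_bound k B nz.
pose S := \sum_x `|m x|; have S0 : 0 <= S by apply: sumr_ge0.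
pose eta0 := Num.min 1 (delta / (1 + S)).
have eta00 : 0 < eta0 by rewrite lt_min ltr01 divr_gt0 //; lra.
have box lam u : lams - eta0 < lam <= lams -> (forall x, res lam u x = 0) ->
    forall x, - B <= u x <= M.
  move=> /andP[l1 l2] ru.
  have e1 : eta0 <= 1 by rewrite ge_min lexx.
  have e2 : eta0 * (1 + S) <= delta.
    by rewrite -ler_pdivlMr ?ge_min ?lexx ?orbT //; lra.
  have uB : forall x, - B <= u x.
    apply: (lower (fun x => b x + m x * lam)) => x; last by rewrite ru; lra.
    apply: le_trans (ler_normD _ _) _.
    apply: le_trans (ler_sum_norm (fun x => `|b x| + m x * (`|lams| + 1)) x).
    rewrite lerD2l normrM gtr0_norm // ler_wpM2l ?(ltW (m_gt0 x)) //.
    have : lams <= `|lams| by exact: ler_norm.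
    have : - lams <= `|lams| by rewrite -normrN ler_norm.
    by rewrite ler_norml => ? ?; apply/andP; split; lra.
  move=> x; rewrite uB /=; apply: (upper (fun x => b x + m x * lam)) => // y.
    have mS : m y <= S by exact: ler_sum_norm.
    have my := ltW (m_gt0 y); apply/andP; split; last by rewrite lerD2l ler_wpM2l.
    suff : m y * (lams - lam) <= delta by lra.
    apply: le_trans e2; rewrite mulrC; apply: ler_pM => //; lra.
  by rewrite ru normr0.
have [lam1 l1 [v rv]] := approx _ eta00.
have vbox := box _ _ l1 rv.
have [|//|u ubox umin] := @box_argmin R V _ _ (fun=> - B) (fun=> M)
  (@continuous_slope k ast) (@closed_box R V (fun=> - B) (fun=> M)).
  by exists v.
exists u; apply: slope_eq0; apply/eqP; rewrite eq_le slope_ge0 andbT leNgt.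
apply/negP => s0; set s := slope _ _ _ in s0.
pose Q := \sum_x (m x * expR (2 * M)) ^+ 2.
have Q0 : 0 <= Q by apply: sumr_ge0 => x _; exact: sqr_ge0.
pose eta := Num.min eta0 (Num.min 1 (s / (1 + Q))).
have eta_gt0 : 0 < eta by rewrite lt_min eta00 lt_min ltr01 divr_gt0 //; lra.
have [lam /andP[l2 l3] [u' ru']] := approx _ eta_gt0.
have e0 : eta <= eta0 by rewrite ge_min lexx.
have e1 : eta <= 1 by rewrite /eta !ge_min lexx ?orbT.
have e2 : eta * (1 + Q) <= s.
  by rewrite -ler_pdivlMr ?(ltr_wpDr Q0) // /eta !ge_min lexx ?orbT.
have u'box : forall x, - B <= u' x <= M by apply: (box lam) => //; apply/andP; split; lra.
have : s <= (lams - lam) ^+ 2 * Q.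
  apply: le_trans (umin u' u'box) _; rewrite mulr_sumr; apply: ler_sum => x _.
  rewrite (residual_shift lams lam) ru' add0r -[leRHS]exprMn.
  rewrite -sqrrN -mulrN opprB mulrC.
  have d0 : 0 <= lams - lam by lra.
  have m0 := ltW (m_gt0 x).
  rewrite ler_pXn2r ?nnegrE ?mulr_ge0 ?expR_ge0 // ler_wpM2l // ler_wpM2l //.
  by rewrite ler_expR; have /andP[_ ?] := u'box x; lra.
have : (lams - lam) ^+ 2 <= eta.
  by rewrite expr2; nra.
move=> d2 sQ; have := ler_wpM2r Q0 d2; lra.
Qed.

End Threshold.

End KazdanWarner.

Theorem theorem2 (R : realType) (V : finType) (e : rel V)
    (e_simple : simple_graph e) (e_connected : connected_graph e)
    (w : V -> V -> R) (w_weight : edge_weight e w)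
    (mu : V -> R) (mu_gt0 : forall x, 0 < mu x)
    (kappa : V -> R) (kappa_lt0 : integral_mu mu kappa < 0)
    (K : V -> R) (K_le_max : forall x, K x <= max_on K) (max_K : max_on K = 0)
    (K_neq0 : ~ (forall x, K x = 0)) :
  exists lamstar : R,
    0 < lamstar < - min_on K /\
    [/\ forall lam : R, lam <= 0 ->
          exists! u : V -> R, solution e w mu kappa K lam u,
        forall lam : R, 0 < lam < lamstar ->
          exists u v : V -> R,
            [/\ u <> v, solution e w mu kappa K lam u
              & solution e w mu kappa K lam v],
        exists u : V -> R, solution e w mu kappa K lamstar u
      & forall lam : R, lamstar < lam ->
          ~ exists u : V -> R, solution e w mu kappa K lam u].
Proof.
have [e_sym _] := e_simple; have [V0 V_conn] := e_connected.
have [_ w_sym w_gt0] := w_weight.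
have [[x0 Kx0] _] := max_onP K V0; have [_ minK] := min_onP K V0.
rewrite max_K in Kx0.
have K_le0 x : K x <= 0 by rewrite -max_K.
have [x1 Kx1] : exists x, K x < 0.
  apply: contrapT => nK; apply: K_neq0 => x; apply/eqP.
  by rewrite eq_le K_le0 leNgt; apply/negP => Kx; apply: nK; exists x.
pose k x := mu x * kappa x; pose b x := mu x * K x.
pose a lam x := b x + mu x * lam.
have k_lt0 : \sum_x k x < 0 by exact: kappa_lt0.
have solE lam u : solution e w mu kappa K lam u <->
    forall x, residual e w k (a lam) u x = 0.
  have E x : residual e w k (a lam) u x =
      mu x * (laplacian e w mu u x + kappa x - (K x + lam) * expR (2 * u x)).
    rewrite /residual /laplacian -/(lap e w u x) /k /a /b.
    by field; rewrite gt_eqF.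
  split=> sol x; first by rewrite E sol mulr0.
  have /eqP := sol x; rewrite E mulf_eq0 gt_eqF //= => /eqP //.
have a_neq0 lam : exists z, a lam z != 0.
  (* [K] vanishes at [x0] and not at [x1], so no constant cancels it. *)
  have [l0|l0] := eqVneq lam 0.
    by exists x1; rewrite /a /b l0 mulr0 addr0 (mulf_neq0 (lt0r_neq0 (mu_gt0 _)) (ltr0_neq0 Kx1)).
  by exists x0; rewrite /a /b Kx0 mulr0 add0r mulf_neq0 // gt_eqF.
pose S := solvable e w k b mu.
have S_ub lam : S lam -> lam < - min_on K.
  move=> [u ru]; rewrite ltNge; apply/negP => lamK.
  have := sum_residual e_sym w_sym k (a lam) u.
  rewrite big1 => [|x _]; last exact: ru.
  have : 0 <= \sum_x a lam x * expR (2 * u x).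
    apply: sumr_ge0 => x _; rewrite mulr_ge0 ?expR_ge0 //.
    by rewrite /a /b -mulrDr mulr_ge0 ?(ltW (mu_gt0 x)) //; have := minK x; lra.
  lra.
have [lam0 lam0_gt0 S_lam0] : exists2 lam, 0 < lam & S lam.
  have [||lam lam_gt0 [v rv]] := @small_supersolution _ _ _ _ e_sym w_sym w_gt0 V_conn k b mu x1 _ _ mu_gt0.
  - by move=> x; rewrite /b mulr_ge0_le0 // ltW.
  - by rewrite /b nmulr_llt0.
  exists lam => //.
  have [_ [u [_ _ ru _]]] :=
    supersolution_minimizer e_sym w_sym w_gt0 V_conn k_lt0 rv.
  by exists u.
have S_sup : has_sup S.
  by split; [exists lam0|exists (- min_on K) => lam /S_ub /ltW].
have S_le lam : S lam -> lam <= sup S by move=> Sl; apply: sup_upper_bound.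
have S_sup_in : S (sup S).
  apply: (solvable_closed e_sym w_sym w_gt0 V_conn k_lt0 mu_gt0) => [|eta eta0].
    exact: a_neq0.
  have [lam Slam lam_near] := sup_adherent eta0 S_sup.
  by exists lam => //; rewrite lam_near S_le.
exists (sup S); split; first by rewrite S_ub // (lt_le_trans lam0_gt0) ?S_le.
split.
- move=> lam lam_le0.
  have [u ru] : S lam.
    apply: (solvable_downward e_sym w_sym w_gt0 V_conn k_lt0 mu_gt0) S_sup_in.
    by apply: le_trans lam_le0 (le_trans (ltW lam0_gt0) (S_le _ S_lam0)).
  exists u; split; first exact/solE.
  move=> v /solE rv.
  apply: (residual_unique e_sym w_sym w_gt0 V_conn) (a_neq0 lam) ru rv.
  move=> x; rewrite /a /b -mulrDr mulr_ge0_le0 ?(ltW (mu_gt0 x)) //.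
  by have := K_le0 x; lra.
- move=> lam /andP[lam_gt0 lam_lt]; have [v rv] := S_sup_in.
  have [||u1 [u2 [u12 r1 r2]]] :=
    @two_solutions _ _ _ _ e_sym w_sym w_gt0 V_conn k (a lam) v x0 k_lt0.
  + by rewrite /a /b Kx0 mulr0 add0r mulr_gt0.
  + move=> x; rewrite (residual_shift _ _ _ _ _ lam (sup S)) rv add0r.
    by rewrite mulr_gt0 ?subr_gt0 // mulr_gt0 ?expR_gt0.
  by exists u1, u2; split=> //; apply/solE.
- by have [u ru] := S_sup_in; exists u; apply/solE.
- move=> lam lam_gt [u /solE ru].
  by have := S_le lam (ex_intro _ u ru); rewrite leNgt lam_gt.
Qed.
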